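(* Let $Z$ be a random variable bounded in $[0,1]$. Let $U$ be a random variable uniformly distributed over $[0,1]$. Suppose $Z$ and $U$ are independent. Then $\mathbb E[Z]=\Pr\{Z\ge U\}$. *)

(* Defs.v *)
From HB Require Import structures.
From mathcomp Require Import all_boot all_order all_algebra.
From mathcomp Require Import all_classical all_reals all_analysis.

Set Implicit Arguments.
Unset Strict Implicit.
Unset Printing Implicit Defensive.

Import Order.TTheory GRing.Theory Num.Theory.

Local Open Scope classical_set_scope.
Local Open Scope ring_scope.
Local Open Scope ereal_scope.

Definition independent_RV (d d1 d2 : measure_display)
    (T : measurableType d) (T1 : measurableType d1) (T2 : measurableType d2)
    (R : realType) (P : probability T R)
    (X : {RV P >-> T1}) (Y : {RV P >-> T2}) : Prop :=
  forall (A : set T1) (B : set T2), measurable A -> measurable B ->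
    P (X @^-1` A `&` Y @^-1` B) = P (X @^-1` A) * P (Y @^-1` B).

(* The two laws are compared on measurable sets only: the values of
   [distribution P X] on other sets carry no meaning. *)
Definition uniformly_distributed (d : measure_display) (T : measurableType d)
    (R : realType) (P : probability T R) (a b : R) (ab : (a < b)%R)
    (X : {RV P >-> R}) : Prop :=
  forall A : set R, measurable A -> distribution P X A = uniform_prob ab A.

(* Main.v *)
(** By independence the joint law of [Z] and [U] is the product of their laws, so Tonelli
    gives [P (U <= Z) = E[F (Z)]], where [F] is the distribution function of [U]; and
    [F z = z] for every [z] in [[0, 1]]. *)
Require Import Defs.
From HB Require Import structures.
From mathcomp Require Import all_boot all_order all_algebra.
From mathcomp Require Import all_classical all_reals all_analysis.
From mathcomp Require Import measurable_realfun.

Set Implicit Arguments.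
Unset Strict Implicit.
Unset Printing Implicit Defensive.

Import Order.TTheory GRing.Theory Num.Theory.

Local Open Scope classical_set_scope.
Local Open Scope ring_scope.

Section independence.
Context d d1 d2 (T : measurableType d) (T1 : measurableType d1)
  (T2 : measurableType d2) (R : realType) (P : probability T R).
Variables (X : {RV P >-> T1}) (Y : {RV P >-> T2}).
Local Open Scope ereal_scope.

(** Made a random variable below so that the joint law is [distribution P RV_pair]. *)
Definition RV_pair (w : T) : T1 * T2 := (X w, Y w).

Lemma measurable_RV_pair : measurable_fun setT RV_pair.
Proof. by apply: measurable_fun_pair; exact: measurable_funPT. Qed.

HB.instance Definition _ :=
  isMeasurableFun.Build _ _ _ _ RV_pair measurable_RV_pair.

Lemma measurable_distribution_xsection (E : set (T1 * T2)) : measurable E ->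
  measurable_fun setT (fun w => distribution P Y (xsection E (X w))).
Proof.
move=> mE; apply: (measurableT_comp (f := distribution P Y \o xsection E)).
  exact: measurable_fun_xsection.
exact: measurable_funPT.
Qed.

(** Independence makes the joint law agree with the product of the laws on rectangles, hence on all
    measurable sets. *)
Lemma independent_joint_law (E : set (T1 * T2)) :
  independent_RV X Y -> measurable E ->
  P [set w | E (X w, Y w)] = \int[P]_w distribution P Y (xsection E (X w)).
Proof.
move=> XY mE.
rewrite -[LHS]/(distribution P RV_pair E).
have <- : (distribution P X \x distribution P Y) E = distribution P RV_pair E.
  by apply: product_measure_unique => // A B mA mB; exact: XY.
(* The product measure of [E] unfolds to the integral of its section measures against the law of
   [X], which is then pulled back along [X]. *)
rewrite [LHS]ge0_integral_distribution//.
exact: measurable_fun_xsection.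
Qed.

End independence.

(** The density is 1 on [0, 1], so the value is the length of [0, z]. *)
Lemma uniform_prob01_le (R : realType) (z : R) : 0 <= z <= 1 ->
  uniform_prob (@ltr01 R) [set u | u <= z] = z%:E.
Proof.
move=> /andP[z0 z1]; rewrite /uniform_prob integral_uniform_pdf.
have -> : [set u | u <= z] `&` `[0, 1] = `[0, z]%classic.
  apply/seteqP; split=> u /=; rewrite !in_itv/=.
    by move=> [uz /andP[-> _]].
  by move=> /andP[-> uz]; split=> //; exact: le_trans z1.
rewrite (eq_integral (fun=> 1%E)); last first.
  move=> u; rewrite inE/= in_itv/= /uniform_pdf => /andP[-> uz].
  by rewrite (le_trans uz z1) subr0 invr1.
rewrite integral_cst//= mul1e lebesgue_measure_itv/= lte_fin sube0.
(* The length formula branches on [0 < z]; otherwise it returns 0, and then [z = 0]. *)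
by case: ltP => // z0'; congr EFin; apply/le_anti; rewrite z0.
Qed.

Theorem theorem12 (d : measure_display) (T : measurableType d) (R : realType)
    (P : probability T R) (Z U : {RV P >-> R})
    (hZ : {ae P, forall w : T, 0 <= Z w <= 1})
    (hU : uniformly_distributed (@ltr01 R) U)
    (hZU : independent_RV Z U) :
  ('E_P[Z] = P [set w : T | (Z w >= U w)%R])%E.
Proof.
pose E := [set zu : R * R | zu.2 <= zu.1].
have mE : measurable E.
  by rewrite -[E]setTI; apply: measurable_fun_le.
have mZ : measurable_fun [set: T] (Z : T -> R) := measurable_funPT Z.
rewrite (independent_joint_law hZU mE) expectation_def.
(* The bounds on [Z] hold only almost surely, so the integrands are compared almost everywhere. *)
apply: ae_eq_integral => //.
- exact: ((measurable_EFinP _ _).2 mZ).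
- exact: measurable_distribution_xsection.
- apply: filterS hZ => w Zw _.
  rewrite hU; last exact: measurable_xsection.
  (* The section of [E] at [Z w] is the half-line of all [u <= Z w]. *)
  by rewrite xsectionE -[LHS](uniform_prob01_le Zw).
Qed.
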